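(* Let $k>n\ge 1$ be integers and let $r<\pi$ be real. If $\alpha>\frac{2\pi}{3}$, then there is no graph homomorphism $f\colon \mathrm{Bor}(S^k;r)\to \mathrm{Bor}(S^n;\alpha)$.
   Context: Each sphere $S^n$ carries its geodesic metric $d$, so that it has diameter $\pi$. The Borsuk graph $\mathrm{Bor}(S^n;\alpha)$ is the simple graph (no loops) whose vertex set is $S^n$ and whose edges are all pairs of distinct points $x,x'\in S^n$ with $d(x,x')\ge\alpha$. A graph homomorphism $G\to H$ is a function from the vertices of $G$ to the vertices of $H$ sending edges to edges. Thus (for positive parameters) a graph homomorphism $\mathrm{Bor}(S^k;r)\to\mathrm{Bor}(S^n;\alpha)$ is a (possibly discontinuous) function $f\colon S^k\to S^n$ such that $d(x,x')\ge r$ implies $d(f(x),f(x'))\ge\alpha$. *)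

(* Defs.v *)
From mathcomp Require Import all_boot all_order all_algebra.
From mathcomp Require Import reals trigo.

Set Implicit Arguments.
Unset Strict Implicit.
Unset Printing Implicit Defensive.

Import Order.TTheory GRing.Theory Num.Theory.

Local Open Scope ring_scope.

(* Possibly infinite simple graphs. *)
Record simple_graph := SimpleGraph {
  vertex :> Type;
  adj : vertex -> vertex -> Prop;
  adj_sym : forall x y, adj x y -> adj y x;
  adj_irrefl : forall x, ~ adj x x
}.

Definition graph_hom (G H : simple_graph) (f : G -> H) : Prop :=
  forall x y : G, adj x y -> adj (f x) (f y).

Definition dotv (R : realType) (m : nat) (u v : 'rV[R]_m) : R :=
  \sum_i u 0 i * v 0 i.

Lemma dotvC (R : realType) (m : nat) (u v : 'rV[R]_m) : dotv u v = dotv v u.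
Proof. by apply: eq_bigr => i _; rewrite mulrC. Qed.

(* S^n, as the unit sphere of R^(n+1). *)
Definition sphere (R : realType) (n : nat) : Type :=
  {x : 'rV[R]_n.+1 | dotv x x == 1}.

(* Great-circle distance.  By Cauchy-Schwarz the argument of acos lies in
   [-1, 1], the range on which acos is the inverse of cos : [0, pi] -> R. *)
Definition geodist (R : realType) (n : nat) (x y : sphere R n) : R :=
  acos (dotv (val x) (val y)).

Lemma geodistC (R : realType) (n : nat) (x y : sphere R n) :
  geodist x y = geodist y x.
Proof. by rewrite /geodist dotvC. Qed.

Definition Bor_adj (R : realType) (n : nat) (alpha : R) (x y : sphere R n) :
  Prop := x <> y /\ alpha <= geodist x y.

Lemma Bor_adj_sym (R : realType) (n : nat) (alpha : R) (x y : sphere R n) :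
  Bor_adj alpha x y -> Bor_adj alpha y x.
Proof. by case=> /nesym neq_yx le_d; split; rewrite // geodistC. Qed.

Lemma Bor_adj_irrefl (R : realType) (n : nat) (alpha : R) (x : sphere R n) :
  ~ Bor_adj alpha x x.
Proof. by case. Qed.

Definition Bor (R : realType) (n : nat) (alpha : R) : simple_graph :=
  SimpleGraph (@Bor_adj_sym R n alpha) (@Bor_adj_irrefl R n alpha).

(* Main.v *)
Require Import Defs.
From mathcomp Require Import all_boot all_order all_algebra.
From mathcomp Require Import reals trigo.
From mathcomp Require Import zify ring lra.

Set Implicit Arguments.
Unset Strict Implicit.
Unset Printing Implicit Defensive.

Import Order.TTheory GRing.Theory Num.Theory.

Local Open Scope ring_scope.

(* Given a homomorphism f, put h(x) = f(x) - f(-x), an odd map from S^k to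
   R^(n+1).  If x and y are close, then x and -y are nearly antipodal, hence
   adjacent, so <f(x), -f(-y)> >= c > 0.  For points x_i close to each other, a
   convex combination of the h(x_i) is F + G with F in the hull of the f(x_i) and
   G in the hull of the -f(-x_i); then <F, G> >= c and |F + G|^2 >= 2c.  So h,
   although possibly discontinuous, maps small simplices to simplices whose hulls
   avoid a fixed ball around 0, and this contradicts Borsuk-Ulam since k > n.

   Borsuk-Ulam is proved through mod 2 cochains on ordered simplices.  Label a
   vector of R^N far from 0 by a signed index of a large coordinate, and let p be
   the indicator function of the simplices whose labels, sorted by index,
   alternate in sign starting with + (Ky Fan).  Then delta p = (1 + T) p on fine
   simplices, where T is the antipodal involution.  Barycentric subdivision
   commutes with delta and T, so the relation carries over to large simplices;
   there it forces the sum of p over the facets of a cross-polytope to be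
   p(empty) = 1.  But p vanishes on simplices with more than N vertices. *)

(** * Coboundary and alternating labels *)

Section Coboundary.
Variable V : Type.
Implicit Types (p q : seq V -> bool) (s t : seq V).

(** The augmented simplicial coboundary mod 2: the sum of [p] over all deletions of one entry. The
    empty list counts as a simplex, so [delta p [:: v]] is [p [::]]. *)
Fixpoint delta p s : bool :=
  if s is v :: t then p t (+) delta (fun u => p (v :: u)) t else false.

Lemma eq_delta p q : p =1 q -> delta p =1 delta q.
Proof.
by move=> + s; elim: s p q => //= v s IH p q pq; rewrite pq (IH _ (fun u => q (v :: u))).
Qed.

Lemma delta_addb p q s :
  delta (fun t => p t (+) q t) s = delta p s (+) delta q s.
Proof.
elim: s p q => //= v s IH p q.
rewrite (IH (fun u => p (v :: u)) (fun u => q (v :: u))).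
by rewrite !addbA; congr addb; rewrite -!addbA; congr addb; rewrite addbC.
Qed.

Lemma delta_false s : delta (fun=> false) s = false.
Proof. by elim: s => //= v s ->. Qed.

Lemma delta_delta p s : delta (delta p) s = false.
Proof.
elim: s p => //= v s IH p.
by rewrite (delta_addb p (delta (fun u => p (v :: u)))) IH addbF addbb.
Qed.

End Coboundary.

Lemma delta_local (V : eqType) (p q : seq V -> bool) (s : seq V) :
  (forall t, subseq t s -> (size t).+1 = size s -> p t = q t) ->
  delta p s = delta q s.
Proof.
elim: s p q => //= v s IH p q pq; congr addb.
  by apply: pq => //; exact: subseq_cons.
apply: IH => t ts sz; apply: pq; last by rewrite /= sz.
by rewrite /= eqxx.
Qed.

Lemma delta_map (V W : Type) (f : V -> W) (p : seq W -> bool) (s : seq V) :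
  delta (fun t => p (map f t)) s = delta p (map f s).
Proof.
by elim: s p => //= v s IH p; rewrite (IH (fun u => p (f v :: u))).
Qed.

(** For symmetric [p] the coboundary is a sum over the entries [x] of [p (rem x s)]. If [x] is
    repeated, [rem] may delete another copy, which only permutes the facet. *)
Lemma delta_perm (V : eqType) (p : seq V -> bool) (s t : seq V) :
  (forall u v, perm_eq u v -> p u = p v) -> perm_eq s t ->
  delta p s = delta p t.
Proof.
have deltaE u : forall q : seq V -> bool,
    (forall u v, perm_eq u v -> q u = q v) ->
    delta q u = \big[addb/false]_(x <- u) q (rem x u).
  elim: u => [|v u IH] q qP; first by rewrite big_nil.
  rewrite big_cons /= eqxx; congr addb.
  rewrite IH; last by move=> a b ab; apply: qP; rewrite perm_cons.
  rewrite big_seq [RHS]big_seq; apply: eq_bigr => x xu.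
  apply: qP; case: eqVneq => [->|_ //].
  by rewrite perm_sym perm_to_rem.
move=> pP st; rewrite !deltaE // (perm_big _ st) /=.
apply: eq_bigr => x _; apply: pP.
case xs: (x \in s); last first.
  by rewrite !rem_id // -?(perm_mem st) ?xs.
rewrite -(perm_cons x) -(permPl (perm_to_rem xs)).
by apply: (perm_trans st); apply: perm_to_rem; rewrite -(perm_mem st).
Qed.

(* Labels are natural numbers: the absolute value of [l] is [l./2], its sign is
   [odd l]. *)
Definition flip (l : nat) : nat := if odd l then l.-1 else l.+1.

Fixpoint alternating (b : bool) (s : seq nat) : bool :=
  if s is l :: t then (odd l == b) && alternating (~~ b) t else true.

Lemma odd_flip l : odd (flip l) = ~~ odd l.
Proof. by rewrite /flip; case: ifP; lia. Qed.

Lemma alternating_flip b s :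
  alternating b (map flip s) = alternating (~~ b) s.
Proof.
elim: s b => //= l s IH b; rewrite IH odd_flip.
by congr (_ && _); case: (odd l) b => [] [].
Qed.

(** If exactly one adjacent pair has equal signs, dropping either member gives the same signs, so
    these facets cancel. In an alternating list only dropping the last entry keeps the pattern with
    the same first sign, and only dropping the first entry reverses that sign. *)
Lemma delta_alternating b s : s != [::] ->
  delta (alternating b) s = alternating b s (+) alternating (~~ b) s.
Proof.
elim: s b => //= l [|l' s] IH b _; first by case: (odd l) b => [] [].
move: (l' :: s) IH (isT : l' :: s != [::]) => u IH u0 /=.
have [e|ne] := eqVneq (odd l) b.
  rewrite (@eq_delta _ _ (alternating (~~ b))) // IH // negbK.
  by rewrite addbC -addbA addbb e; case: (b).
rewrite (@eq_delta _ _ (fun=> false)) // delta_false negbK.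
by rewrite addbF; case: (odd l) b ne => [] [].
Qed.

Definition fan (s : seq nat) : bool := alternating true (sort leq s).

Definition no_opposite (s : seq nat) : Prop :=
  forall x y, x \in s -> y \in s -> x <> flip y.

Lemma sort_leq_perm (s t : seq nat) : perm_eq s t -> sort leq s = sort leq t.
Proof. by move/(perm_sortP leq_total leq_trans anti_leq). Qed.

(** [flip] swaps [2i] and [2i + 1], so it reverses the order only within such a pair, and
    [no_opposite] excludes having both members. *)
Lemma sort_flip s : no_opposite s ->
  sort leq (map flip s) = map flip (sort leq s).
Proof.
move=> ns.
rewrite (sort_leq_perm (t := map flip (sort leq s))); last first.
  by apply: perm_map; rewrite perm_sym perm_sort.
apply: (sorted_sort leq_trans); rewrite sorted_map.
apply: (@sub_in_sorted _ (mem (sort leq s)) leq); first last.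
- exact: (sort_sorted leq_total).
- by apply/allP.
move=> x y; rewrite !mem_sort => xs ys /= xy.
have := ns _ _ xs ys; have := ns _ _ ys xs; rewrite /flip /=.
by case: ifP; case: ifP; lia.
Qed.

Lemma delta_fan s : s != [::] -> no_opposite s ->
  delta fan s = fan s (+) fan (map flip s).
Proof.
move=> s0 ns; rewrite (@delta_perm _ fan s (sort leq s)); first last.
- by rewrite perm_sym perm_sort.
- by move=> u v /sort_leq_perm e; rewrite /fan e.
rewrite (@delta_local _ _ (alternating true)); last first.
  move=> t ts _; rewrite /fan (sorted_sort leq_trans) //.
  by apply: (subseq_sorted leq_trans ts); exact: (sort_sorted leq_total).
rewrite delta_alternating; last by rewrite -size_eq0 size_sort size_eq0.
by rewrite /fan sort_flip // alternating_flip.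
Qed.

(** In a sorted alternating list neighbours differ in sign and are not opposite, so their indices
    strictly increase; only [m] indices are available. *)
Lemma fan_eq_false m s : no_opposite s ->
  (forall x, x \in s -> (x < m.*2)%N) -> (m < size s)%N -> fan s = false.
Proof.
move=> ns lt_s; apply: contraTF => fs; rewrite -leqNgt.
rewrite -(size_sort leq) -(size_map half) -[leqRHS](size_iota 0).
apply: uniq_leq_size; last first.
  by move=> _ /mapP[x + ->]; rewrite mem_sort mem_iota => /lt_s; lia.
apply: (sorted_uniq ltn_trans ltnn); rewrite sorted_map.
have: {in sort leq s &, forall x y, x <> flip y}.
  by move=> x y; rewrite !mem_sort; exact: ns.
have := sort_sorted leq_total s.
move: fs; rewrite /fan; elim: (sort leq s) true => //= x u IH b.
move=> /andP[/eqP ox au] xu nu.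
have {}IH : sorted (relpre half ltn) u.
  apply: (IH (~~ b)) => //; first exact: path_sorted xu.
  by move=> y z yu zu; apply: nu; rewrite inE ?yu ?zu orbT.
case: u xu nu au IH => //= y u /andP[xy _] nu /andP[/eqP oy _] ->.
rewrite andbT.
have := nu x y; have := nu y x; rewrite !inE !eqxx !orbT /= /flip.
by move=> /(_ isT isT) + /(_ isT isT); rewrite ox oy; case: (b) ox oy => /=; lia.
Qed.

(** * Barycentric subdivision *)

Section Subdivision.
Variables (R : realFieldType) (m : nat).
Notation V := 'rV[R]_m.
Implicit Types (p q : seq V -> bool) (s t : seq V) (C : V -> Prop).

Definition bary s : V := (size s)%:R^-1 *: \sum_(x <- s) x.

(* Mod 2 barycentric subdivision, as an operation on cochains; the first
   argument is the number of vertices. *)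
Fixpoint sd_rec (n : nat) p s : bool :=
  if n is n'.+1 then delta (sd_rec n' (fun t => p (bary s :: t))) s else p s.

Definition sd p s : bool := sd_rec (size s) p s.

Lemma sd_rec_addb n p q s :
  sd_rec n (fun t => p t (+) q t) s = sd_rec n p s (+) sd_rec n q s.
Proof.
elim: n p q s => //= n IH p q s; rewrite -delta_addb.
apply: eq_delta => t.
exact: (IH (fun t => p (bary s :: t)) (fun t => q (bary s :: t))).
Qed.

(** On a cone [b :: t], [delta p] is [p t] plus the coboundary of [p (b :: _)]. By induction the
    second part contributes a double coboundary, hence zero. *)
Lemma delta_sd_rec n p s : size s = n.+1 ->
  delta (sd_rec n p) s = sd_rec n.+1 (delta p) s.
Proof.
elim: n p s => [|n IH] p s sz.
  by case: s sz => [|x []] //= _; rewrite !addbF.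
set b := bary s.
transitivity (delta (fun t => sd_rec n.+1 p t (+)
   sd_rec n.+1 (delta (fun u => p (b :: u))) t) s); last first.
  by apply: eq_delta => t; rewrite -sd_rec_addb.
rewrite delta_addb.
rewrite [X in _ (+) X](_ : _ = false) ?addbF //.
rewrite (@delta_local _ _ (delta (sd_rec n (fun u => p (b :: u))))).
  exact: delta_delta.
by move=> t _; rewrite sz => -[szt]; rewrite -IH.
Qed.

Lemma delta_sd p s : s != [::] -> delta (sd p) s = sd (delta p) s.
Proof.
case: s => // x s _; rewrite {2}/sd -delta_sd_rec //.
by apply: delta_local => t _ [szt]; rewrite /sd szt.
Qed.

Lemma bary_opp s : bary (map -%R s) = - bary s.
Proof. by rewrite /bary size_map big_map sumrN scalerN. Qed.

Lemma sd_opp p s : sd (fun t => p (map -%R t)) s = sd p (map -%R s).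
Proof.
rewrite /sd size_map; move: (size s) => n; elim: n p s => //= n IH p s.
rewrite bary_opp -delta_map; apply: eq_delta => t /=.
exact: (IH (fun u => p (- _ :: u))).
Qed.

Definition convex C : Prop := forall x y (a : R),
  0 <= a <= 1 -> C x -> C y -> C (a *: x + (1 - a) *: y).

Definition mesh_le (d : R) s : Prop :=
  forall x y i, x \in s -> y \in s -> x 0 i - y 0 i <= d.

(** The bound [M] on the number of vertices makes the contraction factor [1 - M^-1] of a subdivision
    uniform over all sizes. *)
Definition fine (M : nat) C (d : R) s : Prop :=
  [/\ (size s <= M)%N, forall x, x \in s -> C x & mesh_le d s].

Lemma convex_bary C s : convex C -> s != [::] ->
  (forall x, x \in s -> C x) -> C (bary s).
Proof.
move=> cC; elim: s => // x [|y s] IH _ Cs.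
  by rewrite /bary /= big_seq1 invr1 scale1r; apply: Cs; rewrite inE.
have Cb : C (bary (y :: s)) by apply: IH => // z zs; apply: Cs; rewrite inE zs orbT.
set n := size (y :: s) in Cb *; have n0 : (n%:R : R) != 0 by rewrite pnatr_eq0.
have n10 : (n.+1%:R : R) != 0 by rewrite pnatr_eq0.
have -> : bary (x :: y :: s) =
    n.+1%:R^-1 *: x + (1 - n.+1%:R^-1) *: bary (y :: s).
  rewrite /bary big_cons scalerDr; congr (_ + _).
  rewrite scalerA; congr (_ *: _).
  rewrite -/n /= -/n -[size s]/(n.-1) /= -natr1 in n10 *.
  by field; rewrite n10 n0.
apply: cC => //; last by apply: Cs; rewrite inE eqxx.
by rewrite invr_ge0 ler0n invf_le1 ?ltr0n // ler1n.
Qed.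

(** The difference is the average of [y - x] over the entries [y] of [s], and the term of [x] itself
    is zero. *)
Lemma mesh_bary M d s x i : (size s <= M)%N -> mesh_le d s -> x \in s ->
  `|bary s 0 i - x 0 i| <= (1 - M%:R^-1) * d.
Proof.
move=> sM ms xs.
have s0 : (0 < size s)%N by case: s xs {sM ms}.
have S0 : (0 : R) < (size s)%:R by rewrite ltr0n.
have d0 : 0 <= d by have := ms x x i xs xs; rewrite subrr.
have md y : y \in s -> `|y 0 i - x 0 i| <= d.
  move=> ys; have := ms x y i xs ys; have := ms y x i ys xs.
  by rewrite ler_norml; lra.
have -> : bary s 0 i - x 0 i =
    (size s)%:R^-1 * \sum_(y <- rem x s) (y 0 i - x 0 i).
  apply: (canRL (mulKf (lt0r_neq0 S0))); rewrite mulrBr.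
  rewrite /bary !mxE mulrA mulfV ?mul1r ?lt0r_neq0 // summxE.
  rewrite (perm_big _ (perm_to_rem xs)) /= big_cons sumrB.
  rewrite big_const_seq count_predT iter_addr_0 size_rem //.
  rewrite -mulr_natl -[X in X%:R * _](prednK s0) -natr1; ring.
rewrite normrM gtr0_norm ?invr_gt0 //.
have : `|\sum_(y <- rem x s) (y 0 i - x 0 i)| <= (size s).-1%:R * d.
  apply: le_trans (ler_norm_sum _ _ _) _.
  rewrite big_seq; apply: (@le_trans _ _ (\sum_(y <- rem x s | y \in rem x s) d)).
    by apply: ler_sum => y /mem_rem; exact: md.
  by rewrite -big_seq big_const_seq count_predT iter_addr_0 size_rem // mulr_natl.
move/(ler_wpM2l (ltW (etrans (invr_gt0 _) S0))) => /le_trans; apply.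
rewrite mulrA; apply: ler_wpM2r => //.
have -> : (size s).-1%:R = (size s)%:R - 1 :> R.
  by rewrite -[in RHS](prednK s0) -natr1 addrK.
rewrite mulrBr mulr1 mulVf ?lt0r_neq0 // lerD2l lerN2.
by rewrite lef_pV2 ?posrE ?ltr0n ?ler_nat //; apply: leq_trans sM.
Qed.

Lemma convex_and C C' : convex C -> convex C' -> convex (fun x => C x /\ C' x).
Proof. by move=> c c' x y a a01 [? ?] [? ?]; split; [exact: c|exact: c']. Qed.

Lemma convex_near (b : V) (d : R) :
  convex (fun x => forall i, `|b 0 i - x 0 i| <= d).
Proof.
move=> x y a /andP[a0 a1] hx hy i; rewrite !mxE.
move: (hx i) (hy i); rewrite !ler_norml => /andP[h1 h2] /andP[h3 h4].
by apply/andP; split; nra.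
Qed.

Lemma sd_local M C d p q s : convex C -> fine M C d s ->
  (forall t, size t = size s -> fine M C ((1 - M%:R^-1) * d) t -> p t = q t) ->
  sd p s = sd q s.
Proof.
rewrite /sd; move en: (size s) => n.
elim: n C p q s en => [|n IH] C p q s szs cC [sM Cs ms] pq /=.
  case: s szs {sM Cs ms} => // _.
  by apply: pq.
have s0 : s != [::] by case: s szs {sM Cs ms}.
apply: delta_local => t ts; rewrite szs => -[szt].
set b := bary s; set d' := (1 - _) * d in pq.
have sub x : x \in t -> x \in s by exact: (mem_subseq ts).
have mb x i : x \in s -> `|b 0 i - x 0 i| <= d' by move=> xs; exact: mesh_bary.
(* Adding a box around [b] to the convex set records that all later barycentres stay within [d'] of
   [b]; this bounds the mesh of [b :: u]. *)
apply: (IH (fun x => C x /\ forall i, `|b 0 i - x 0 i| <= d')) => //.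
- by apply: convex_and => //; exact: convex_near.
- split; first by rewrite szt -ltnS -szs (leq_trans sM).
    by move=> x /sub xs; split; [exact: Cs|move=> i; exact: mb].
  by move=> x y i /sub xs /sub ys; exact: ms.
move=> u szu [uM Cu mu]; apply: pq; first by rewrite /= szu.
split; first by rewrite /= szu -szs.
  move=> x; rewrite inE => /predU1P[->|/Cu[]//].
  exact: convex_bary.
move=> x y i; rewrite !inE => /predU1P[->|xu] /predU1P[->|yu].
- have [z zs] : exists z, z \in s.
    by case: (s) s0 => // z ? _; exists z; rewrite mem_head.
  by rewrite subrr; exact: le_trans (normr_ge0 _) (mb z i zs).
- by have [_ /(_ i)] := Cu _ yu; rewrite ler_norml => /andP[].
- by have [_ /(_ i)] := Cu _ xu; rewrite ler_norml; lra.
- exact: mu.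
Qed.

(* The cocycle relation [delta p = (1 + T) p], T the antipodal involution; one
   cochain [p], defined on simplices of all sizes, plays all degrees at once. *)
Definition antipodal (N : nat) (P : seq V -> Prop) p : Prop :=
  forall s, P s ->
    (s != [::] -> delta p s = p s (+) p (map -%R s)) /\
    ((N < size s)%N -> p s = false).

Lemma antipodal_sd N M C d p : convex C ->
  antipodal N (fine M C ((1 - M%:R^-1) * d)) p ->
  antipodal N (fine M C d) (sd p).
Proof.
move=> cC pP s sP; split => [s0|lt_N].
  rewrite delta_sd //.
  rewrite (sd_local (q := fun t => p t (+) p (map -%R t)) cC sP).
    by rewrite -sd_opp; exact: sd_rec_addb.
  move=> t szt /pP[+ _]; apply.
  by rewrite -size_eq0 szt size_eq0.
rewrite (sd_local (q := fun=> false) cC sP).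
  rewrite /sd; move: (size s) {sP lt_N} => n.
  by elim: n s => //= n IH s; rewrite (eq_delta (q := fun=> false)) ?delta_false.
by move=> t szt /pP[_]; apply; rewrite szt.
Qed.

Lemma antipodal_iter_sd N M C d p j : convex C ->
  antipodal N (fine M C ((1 - M%:R^-1) ^+ j * d)) p ->
  antipodal N (fine M C d) (iter j sd p).
Proof.
move=> cC; elim: j d => [|j IH] d; first by rewrite mul1r.
rewrite exprSr -mulrA => /IH pP; exact: antipodal_sd.
Qed.

Lemma iter_sd_nil p j : iter j sd p [::] = p [::].
Proof. by elim: j. Qed.

(* The sum of [p] over all simplices [(+-e_0, ..., +-e_l)], that is, over the
   facets of a cross-polytope. *)
Fixpoint cross p (es : seq V) : bool :=
  if es is e :: es' then
    cross (fun t => p (e :: t)) es' (+) cross (fun t => p (- e :: t)) es'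
  else p [::].

Definition signing (es t : seq V) : bool :=
  all2 (fun e x => (x == e) || (x == - e)) es t.

Lemma cross_local p q es : (forall t, signing es t -> p t = q t) ->
  cross p es = cross q es.
Proof.
elim: es p q => [|e es IH] p q pq /=; first exact: pq.
by congr addb; apply: IH => t ht; apply: pq; rewrite /signing /= eqxx ?orbT.
Qed.

Lemma cross_addb p q es :
  cross (fun t => p t (+) q t) es = cross p es (+) cross q es.
Proof.
elim: es p q => //= e es IH p q.
rewrite (IH (fun t => p (e :: t)) (fun t => q (e :: t))).
rewrite (IH (fun t => p (- e :: t)) (fun t => q (- e :: t))).
by rewrite !addbA; congr addb; rewrite -!addbA; congr addb; rewrite addbC.
Qed.

Lemma cross_opp p es : cross (fun t => p (map -%R t)) es = cross p es.
Proof.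
elim: es p => //= e es IH p; rewrite addbC opprK.
by rewrite (IH (fun t => p (e :: t))) (IH (fun t => p (- e :: t))).
Qed.

(** Every ridge of the cross-polytope lies on exactly two facets. *)
Lemma cross_delta p es : cross (delta p) es = false.
Proof.
elim: es p => //= e es IH p.
rewrite !(cross_addb p) (IH (fun u => p (e :: u))) (IH (fun u => p (- e :: u))).
by rewrite !addbF addbb.
Qed.

(** Pairing [e :: t] with its antipode turns the sum into one of [delta p (e :: t)] over the
    signings [t] of the remaining vertices. The facets through [e] cancel by [cross_delta]; what is
    left is the sum one dimension lower. *)
Lemma cross_antipodal p es :
  (forall u t, subseq u es -> signing u t -> t != [::] ->
     delta p t = p t (+) p (map -%R t)) ->
  cross p es = p [::].
Proof.
elim: es => [//|e es IH] pP.
rewrite -IH; last first.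
  by move=> u t ue; apply: pP; exact: subseq_trans ue (subseq_cons es e).
rewrite [LHS]/= -[X in _ (+) X]cross_opp /= -cross_addb.
rewrite (@cross_local _ (fun t => p t (+) delta (fun u => p (e :: u)) t)).
  by rewrite cross_addb cross_delta addbF.
move=> t ht; rewrite -[RHS]/(delta p (e :: t)) (pP (e :: es)) //.
by rewrite /signing /= eqxx.
Qed.

End Subdivision.

(** * Borsuk-Ulam *)

Section Labels.
Variables (R : realFieldType) (N : nat) (q : R).
Hypothesis q_gt0 : 0 < q.
Implicit Types v : 'rV[R]_N.

Definition visible v : Prop := exists i, q <= v 0 i ^+ 2.

Definition label v : nat :=
  if [pick i | q <= v 0 i ^+ 2] is Some i then ((i : nat).*2 + (0 < v 0 i)%R)%N else 0%N.

Lemma labelP v : visible v ->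
  exists2 i : 'I_N, q <= v 0 i ^+ 2 &
    label v = ((i : nat).*2 + (0 < v 0 i)%R)%N /\
    label (- v) = ((i : nat).*2 + (v 0 i < 0)%R)%N.
Proof.
move=> [i0 qi0]; rewrite /label.
(* The condition is even in [v], so [v] and [- v] pick the same index. *)
rewrite (@eq_pick _ (fun i => q <= (- v) 0 i ^+ 2) (fun i => q <= v 0 i ^+ 2));
  last by move=> i; rewrite mxE sqrrN.
case: pickP => [i qi|/(_ i0)]; last by rewrite /= qi0.
by exists i => //; rewrite mxE oppr_gt0.
Qed.

Lemma label_opp v : visible v -> label (- v) = flip (label v).
Proof.
move=> /labelP[i qi [-> ->]]; rewrite /flip.
have : v 0 i != 0 by apply: contraTneq qi => ->; rewrite expr0n -ltNge.
by case: ltrgt0P => //= _ _; rewrite oddD odd_double /= ?addn1 ?addn0.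
Qed.

Lemma label_lt v : visible v -> (label v < N.*2)%N.
Proof. by case/labelP => i _ [-> _]; have := ltn_ord i; case: (0 < _); lia. Qed.

(** Opposite labels share a coordinate in which the two vectors have opposite signs and squares at
    least [q]; they would differ there by more than [d]. *)
Lemma no_opposite_label (d : R) (s : seq 'rV[R]_N) :
  (forall v, v \in s -> visible v) -> mesh_le d s -> d ^+ 2 < q ->
  no_opposite (map label s).
Proof.
move=> vs ms dq _ _ /mapP[v v_s ->] /mapP[w w_s ->].
have [i qi [-> _]] := labelP (vs v v_s).
have [j qj [-> _]] := labelP (vs w w_s).
have sep (a b : R) : q <= a ^+ 2 -> 0 < a -> ~~ (0 < b) -> a - b <= d -> False.
  by rewrite -leNgt => *; nra.
have [eij|nij] := eqVneq i j; last first.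
  have {}nij : (i : nat) <> j by move/val_inj/eqP; exact/negP.
  by rewrite /flip oddD odd_double /= oddb; case: (0 < _); case: (0 < _) => /=; lia.
rewrite -{j}eij in qj *.
have := sep _ _ qi _ _ (ms v w i v_s w_s).
have := sep _ _ qj _ _ (ms w v i w_s v_s).
rewrite /flip oddD odd_double /= oddb.
by case: (0 < v _ _); case: (0 < w _ _) => /= h1 h2; move=> ?;
  first [by apply: h1 | by apply: h2 | lia].
Qed.

Lemma antipodal_fan (M : nat) (C : 'rV[R]_N -> Prop) (d : R) :
  (forall v, C v -> visible v) -> d ^+ 2 < q ->
  antipodal N (fine M C d) (fun s => fan (map label s)).
Proof.
move=> Cv dq s [sM Cs ms].
have vs v : v \in s -> visible v by move/Cs/Cv.
have ns := no_opposite_label vs ms dq.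
split => [s0|Ns]; last first.
  apply: (@fan_eq_false N); rewrite ?size_map //.
  by move=> _ /mapP[v /vs /label_lt ? ->].
rewrite (delta_map _ fan) delta_fan //; last by case: (s) s0.
congr (_ (+) fan _); rewrite -!map_comp; apply/eq_in_map => v /vs.
by move/label_opp.
Qed.

End Labels.

Lemma exp_shrink (R : realType) (M : nat) (a b : R) : (0 < M)%N -> 0 < b ->
  exists j, (1 - M%:R^-1) ^+ j * a < b.
Proof.
move=> M0 b0; set y : R := M%:R^-1.
have y0 : 0 < y by rewrite invr_gt0 ltr0n.
have y1 : y <= 1 by rewrite invf_le1 ?ltr0n // ler1n.
(* A Bernoulli bound, from [(1 - y)(1 + (j + 1)y) <= 1 + jy]. *)
have pow j : (1 - y) ^+ j * (1 + j%:R * y) <= 1.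
  elim: j => [|j IH]; first by rewrite expr0 mul0r addr0 mulr1.
  apply: le_trans IH; rewrite exprSr -mulrA.
  apply: ler_wpM2l; first by rewrite exprn_ge0 // subr_ge0.
  have := ler0n R j; rewrite -natr1; nra.
have [a0|a0] := leP a 0.
  by exists 0; rewrite mul1r; exact: le_lt_trans b0.
exists (Num.bound (a / (b * y))); set j := Num.bound _.
have := archi_boundP (ltW (divr_gt0 a0 (mulr_gt0 b0 y0))).
rewrite ltr_pdivrMr ?mulr_gt0 // -/j => aj.
have := pow j; set X := (1 - y) ^+ j => Xj.
have X0 : 0 <= X by rewrite exprn_ge0 // subr_ge0.
have [->|X1] := eqVneq X 0; first by rewrite mul0r.
have {X1}X0 : 0 < X by rewrite lt_def X1.
nra.
Qed.

Lemma signing_delta (R : realFieldType) (m : nat) (js : seq 'I_m)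
    (t : seq 'rV[R]_m) :
  uniq js -> signing [seq delta_mx 0 j | j <- js] t ->
  exists2 eps : 'I_m -> R, forall i, eps i ^+ 2 = 1 &
    t = [seq eps j *: delta_mx 0 j | j <- js].
Proof.
elim: js t => [|j js IH] [|x t] //=.
  by exists (fun=> 1) => // i; rewrite expr1n.
move=> /andP[jjs ujs] /andP[xj] /(IH _ ujs)[eps eps1 ->].
pose e : R := (-1) ^+ (x != delta_mx 0 j).
exists (fun i => if i == j then e else eps i).
  by move=> i; case: ifP => // _; rewrite sqrr_sign.
rewrite eqxx; congr (_ :: _).
  by rewrite /e; case: eqVneq xj => [->|_ /= /eqP->]; rewrite ?scale1r ?scaleN1r.
apply/eq_in_map => i ijs; case: eqVneq => // eij.
by rewrite -eij ijs in jjs.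
Qed.

(* A Borsuk-Ulam theorem for discontinuous maps.  Simplices are subdivided twice:
   in the source until [h] sends their vertices into a convex set away from 0,
   then in the target until no two vertices get opposite labels. *)
Lemma discrete_borsuk_ulam (R : realType) (m N : nat)
    (h : 'rV[R]_m -> 'rV[R]_N) (B d q : R) :
  (N < m)%N -> 0 < d -> 0 < q -> 0 <= B -> (forall x, h (- x) = - h x) ->
  (forall x i, `|h x 0 i| <= B) ->
  ~ (forall t, (forall x, x \in t -> 1 <= m%:R * dotv x x) -> mesh_le d t ->
       exists C, [/\ convex C, forall v, C v -> visible q v &
                     forall x, x \in t -> C (h x)]).
Proof.
move=> Nm d0 q0 B0 h_opp hB hC.
have m0 : (0 < m)%N by exact: leq_ltn_trans Nm.
pose K : R := 1 - m%:R^-1.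
(* The initial scales are [2 * B], a mesh bound for values of [h], and, for [j2], the mesh bound 2
   for a facet of the cross-polytope. *)
have [j1 Kj1] : exists j, (K ^+ j * (2 * B)) ^+ 2 < q.
  have e0 : 0 < Num.min 1 q by rewrite lt_min ltr01.
  have [j] := exp_shrink (2 * B) m0 e0.
  rewrite -/K lt_min => /andP[X1 Xq]; exists j.
  have K0 : 0 <= K by rewrite subr_ge0 invf_le1 ?ltr0n // ler1n.
  have X0 : 0 <= K ^+ j * (2 * B) by rewrite mulr_ge0 ?exprn_ge0 // mulr_ge0.
  nra.
have [j2 Kj2] := exp_shrink 2 m0 d0; rewrite -/K in Kj2.
pose p1 := iter j1 (@sd R N) (fun s => fan (map (label q) s)).
(* [p1] does not depend on [C], so one cochain serves all the convex sets that [hC] provides. *)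
have p1P C : convex C -> (forall v, C v -> visible q v) ->
    antipodal N (fine m C (2 * B)) p1.
  move=> cC vC; apply: antipodal_iter_sd => //.
  exact: antipodal_fan.
pose p2 t := p1 (map h t).
pose p3 := iter j2 (@sd R m) p2.
have p3P (eps : 'I_m -> R) : (forall i, eps i ^+ 2 = 1) ->
    antipodal N (fine m (fun x => 1 <= \sum_i eps i * x 0 i) 2) p3.
  move=> eps1; apply: antipodal_iter_sd.
    move=> x y a /andP[a0 a1] x1 y1.
    under eq_bigr => i _ do rewrite !mxE mulrDr !(mulrCA (eps i)).
    rewrite big_split /= -!mulr_sumr; nra.
  move=> t [tm teps mt].
  have [] := hC t.
  - move=> x /teps x1.
    (* Expanding [(m x_i - eps_i)^2 >= 0] gives [1 <= (m |x|^2 + 1) / 2], so this half-space stays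
       away from the origin. *)
    have : \sum_i eps i * x 0 i <=
        \sum_(i < m) (m%:R * (x 0 i * x 0 i) + m%:R^-1) / 2.
      apply: ler_sum => i _; rewrite ler_pdivlMr //.
      rewrite -(ler_pM2l (_ : 0 < m%:R)) ?ltr0n //.
      rewrite [leRHS]mulrDr mulfV ?pnatr_eq0 -?lt0n //.
      have := eps1 i; have := sqr_ge0 (m%:R * x 0 i - eps i); nra.
    rewrite -mulr_suml big_split /= -mulr_sumr sumr_const card_ord.
    rewrite -(mulr_natl m%:R^-1) mulfV ?pnatr_eq0 -?lt0n // -/(dotv x x).
    lra.
  - by move=> x y i xt yt; apply: le_trans (ltW Kj2); exact: mt.
  move=> C [cC vC Ch].
  have [|rel van] := p1P C cC vC (map h t).
    split; rewrite ?size_map //; first by move=> _ /mapP[x /Ch ? ->].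
    move=> _ _ i /mapP[x _ ->] /mapP[y _ ->].
    by have := hB x i; have := hB y i; rewrite !ler_norml; lra.
  split; last by rewrite -(size_map h).
  move=> t0; rewrite /p2 (delta_map h p1) rel; last by case: (t) t0.
  by congr (_ (+) p1 _); rewrite -!map_comp; apply: eq_map => x /=; rewrite h_opp.
pose es : seq 'rV[R]_m := [seq delta_mx 0 i | i <- enum 'I_m].
have es_fine u t : subseq u es -> signing u t ->
    exists2 eps : 'I_m -> R, forall i, eps i ^+ 2 = 1 &
      fine m (fun x => 1 <= \sum_i eps i * x 0 i) 2 t.
  case/subseqP => b _ ->; rewrite -map_mask.
  have : subseq (mask b (enum 'I_m)) (enum 'I_m) by exact: mask_subseq.
  move: (mask _ _) => js sub /signing_delta[|eps eps1 ->].
    by apply: subseq_uniq sub _; exact: enum_uniq.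
  exists eps => //; split.
  - by rewrite size_map -[leqRHS](size_enum_ord m); exact: size_subseq.
  - move=> _ /mapP[j _ ->]; rewrite (bigD1 j) //= !mxE !eqxx mulr1 -expr2 eps1.
    rewrite big1 ?addr0 // => i /negbTE ij.
    by rewrite !mxE ij andbF !mulr0.
  have le1 j i : -1 <= (eps j *: delta_mx 0 j : 'rV[R]_m) 0 i <= 1.
    rewrite !mxE eqxx /=; have := eps1 j.
    by case: (i == j); rewrite ?mulr1 ?mulr0 => e1; apply/andP; split; nra.
  move=> _ _ i /mapP[a _ ->] /mapP[b' _ ->].
  by have := le1 a i; have := le1 b' i; lra.
have cross_false : cross (fun=> false) es = false.
  by elim: es {es_fine} => //= e es ->.
(* The total is the value at the empty simplex, whose label list is alternating; yet [p3] vanishes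
   on each facet, which has [m > N] vertices. *)
have : cross p3 es = true.
  rewrite cross_antipodal; first by rewrite /p3 iter_sd_nil /p2 /p1 iter_sd_nil.
  move=> u t /es_fine + /[dup] + => /[apply] -[eps /p3P eP /eP[rel _]] _.
  exact: rel.
rewrite (@cross_local _ _ _ (fun=> false)) ?cross_false //.
move=> t /[dup] st /(es_fine _ _ (subseq_refl _))[eps /p3P eP /eP[_]]; apply.
suff -> : size t = m by [].
move: st; rewrite /signing all2E => /andP[/eqP <- _].
by rewrite size_map size_enum_ord.
Qed.

(** * Borsuk graphs *)

Section DotProduct.
Variables (R : realType) (m : nat).
Implicit Types u v w : 'rV[R]_m.

Lemma dotvDl u v w : dotv (u + v) w = dotv u w + dotv v w.
Proof. by rewrite -big_split; apply: eq_bigr => i _; rewrite mxE mulrDl. Qed.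

Lemma dotvZl a u v : dotv (a *: u) v = a * dotv u v.
Proof. by rewrite mulr_sumr; apply: eq_bigr => i _; rewrite mxE mulrA. Qed.

Lemma dotvZr a u v : dotv u (a *: v) = a * dotv u v.
Proof. by rewrite dotvC dotvZl dotvC. Qed.

Lemma dotvNr u v : dotv u (- v) = - dotv u v.
Proof. by rewrite -scaleN1r dotvZr mulN1r. Qed.

Lemma dotvDr u v w : dotv u (v + w) = dotv u v + dotv u w.
Proof. by rewrite ![dotv u _]dotvC dotvDl. Qed.

Lemma dotv_ge0 u : 0 <= dotv u u.
Proof. by apply: sumr_ge0 => i _; rewrite -expr2 sqr_ge0. Qed.

Lemma dotv_unit_le1 u v : dotv u u = 1 -> dotv v v = 1 -> -1 <= dotv u v <= 1.
Proof.
move=> u1 v1; have := dotv_ge0 (u + v); have := dotv_ge0 (u - v).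
rewrite !(dotvDl, dotvDr) -scaleN1r !(dotvZl, dotvZr) u1 v1 (dotvC v u).
by move=> *; apply/andP; split; lra.
Qed.

Lemma coord_unit_le1 u i : dotv u u = 1 -> `|u 0 i| <= 1.
Proof.
move=> u1; suff : u 0 i ^+ 2 <= 1 by move=> ?; rewrite ler_norml; apply/andP; split; nra.
rewrite -u1 /dotv (bigD1 i) //= -expr2 lerDl.
by apply: sumr_ge0 => j _; rewrite -expr2 sqr_ge0.
Qed.

Lemma convex_dotv_ge (c : R) v : convex (fun u => c <= dotv u v).
Proof. by move=> x y a /andP[a0 a1] hx hy; rewrite dotvDl !dotvZl; nra. Qed.

End DotProduct.

(** As an intersection of convex sets, the hull needs no coefficients: a linear inequality passes
    from the vertices to the hull by taking [C] to be a half-space. *)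
Definition hull (R : realFieldType) (m : nat) (s : seq 'rV[R]_m)
    (x : 'rV[R]_m) : Prop :=
  forall C, convex C -> (forall y, y \in s -> C y) -> C x.

Lemma hull_sub (R : realFieldType) (m : nat) (s : seq 'rV[R]_m) x :
  x \in s -> hull s x.
Proof. by move=> xs C _ sC; exact: sC. Qed.

Lemma hull_convex (R : realFieldType) (m : nat) (s : seq 'rV[R]_m) :
  convex (hull s).
Proof. by move=> x y a a01 hx hy C cC sC; exact: cC (hx C cC sC) (hy C cC sC). Qed.

Lemma hull_dotv_ge (R : realType) (m : nat) (s t : seq 'rV[R]_m) (c : R) u v :
  (forall x y, x \in s -> y \in t -> c <= dotv x y) ->
  hull s u -> hull t v -> c <= dotv u v.
Proof.
move=> st hu hv; apply: (hu _ (@convex_dotv_ge R m c v)) => x xs.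
rewrite dotvC; apply: (hv _ (@convex_dotv_ge R m c x)) => y yt.
by rewrite dotvC; exact: st.
Qed.

Section Geodist.
Variable R : realType.

Lemma geodist_ge_cos n (a : R) (x y : sphere R n) : 0 <= a <= pi ->
  (a <= geodist x y) = (dotv (val x) (val y) <= cos a).
Proof.
move=> a0pi; rewrite /geodist.
have d1 := dotv_unit_le1 (eqP (valP x)) (eqP (valP y)).
rewrite -[in RHS](acosK (x := dotv _ _)) ?in_itv //=.
by rewrite !leNgt ltr_cos // in_itv //= acos_ge0 // acos_lepi.
Qed.

Variables (k : nat).

Lemma dotv_delta_mx0 : dotv (delta_mx 0 0 : 'rV[R]_k.+1) (delta_mx 0 0) == 1.
Proof.
rewrite /dotv big_ord_recl big1; first by rewrite !mxE /= mulr1 addr0.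
by move=> i _; rewrite !mxE /= mul0r.
Qed.

(* Radial projection; the value at [x = 0] is a junk point. *)
Definition radial (x : 'rV[R]_k.+1) : sphere R k :=
  insubd (Sub (delta_mx 0 0) dotv_delta_mx0 : sphere R k)
    ((Num.sqrt (dotv x x))^-1 *: x).

Lemma val_radial x : 0 < dotv x x ->
  val (radial x) = (Num.sqrt (dotv x x))^-1 *: x.
Proof.
move=> x0; rewrite /radial val_insubd dotvZl dotvZr mulrA -expr2 exprVn.
by rewrite sqr_sqrtr ?mulVf ?eqxx ?ltW // gt_eqF.
Qed.

(** With [a = |x|], [b = |y|] and [M = k + 1], one has [2<x,y> = a^2 + b^2 - |x - y|^2 >= 2ab - M
    d^2]; divide by [2ab >= 2/M]. *)
Lemma dotv_radial_ge x y (d : R) :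
  1 <= k.+1%:R * dotv x x -> 1 <= k.+1%:R * dotv y y ->
  (forall i, `|x 0 i - y 0 i| <= d) ->
  1 - (k.+1%:R * d) ^+ 2 / 2 <= dotv (val (radial x)) (val (radial y)).
Proof.
set M := k.+1%:R => hx hy hd.
have M0 : 0 < M by rewrite ltr0n.
have x0 : 0 < dotv x x by rewrite -(pmulr_rgt0 _ M0); lra.
have y0 : 0 < dotv y y by rewrite -(pmulr_rgt0 _ M0); lra.
rewrite !val_radial // dotvZl dotvZr.
set a := Num.sqrt _; set b := Num.sqrt _.
have a0 : 0 < a by rewrite sqrtr_gt0.
have b0 : 0 < b by rewrite sqrtr_gt0.
have ea : a ^+ 2 = dotv x x by rewrite sqr_sqrtr ?ltW.
have eb : b ^+ 2 = dotv y y by rewrite sqr_sqrtr ?ltW.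
have dxy : dotv (x - y) (x - y) <= M * d ^+ 2.
  rewrite /M -[k.+1 in leRHS]card_ord mulr_natl -sumr_const.
  apply: ler_sum => i _; rewrite !mxE -expr2 -real_normK ?num_real //.
  by rewrite lerXn2r ?nnegrE //; exact: le_trans (hd i).
move: dxy; rewrite dotvDl !dotvDr -scaleN1r !(dotvZl, dotvZr) (dotvC y x).
rewrite -ea -eb => dxy.
have Mab : 1 <= M * (a * b).
  have : 1 <= (M * (a * b)) ^+ 2.
    rewrite (_ : _ ^+ 2 = (M * a ^+ 2) * (M * b ^+ 2)); last by ring.
    by rewrite ea eb; apply: mulr_ege1.
  by have := mulr_gt0 M0 (mulr_gt0 a0 b0); nra.
rewrite mulrA -invfM [leRHS]mulrC ler_pdivlMr ?mulr_gt0 //.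
have ab0 := mulr_gt0 b0 a0.
have := ler_wpM2l (mulr_ge0 (ltW M0) (sqr_ge0 d)) Mab.
have := sqr_ge0 (a - b); nra.
Qed.

End Geodist.

Theorem theorem10p3 (R : realType) (k n : nat) (r alpha : R) :
  (1 <= n)%N -> (n < k)%N -> r < pi -> 2 * pi / 3 < alpha ->
  ~ exists f : Bor k r -> Bor n alpha, graph_hom f.
Proof.
move=> _ nk r_lt alpha_gt [f fhom].
have pi0 := pi_gt0 R.
pose c : R := - cos (2 * pi / 3).
have c0 : 0 < c.
  rewrite oppr_gt0 -(cos_pihalf R) ltr_cos ?in_itv /=; first lra.
  - by apply/andP; split; lra.
  - by apply/andP; split; lra.
(* Distance at least [r'] is still at least [r], and [r' >= pi / 2] makes [kappa] nonpositive. *)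
pose r' : R := Num.max r (pi / 2).
have r'0 : pi / 2 <= r' by rewrite le_max lexx orbT.
have r'pi : r' < pi by rewrite gt_max r_lt; lra.
have rr' : r <= r' by rewrite le_max lexx.
pose kappa := cos r'.
have kappa0 : kappa <= 0.
  rewrite -(cos_pihalf R) leNgt ltr_cos ?in_itv /= -?leNgt //.
  - by apply/andP; split; lra.
  - by apply/andP; split; lra.
have kappa1 : -1 < kappa.
  rewrite -(cospi R) ltr_cos ?in_itv /= //.
  - by apply/andP; split; lra.
  - by apply/andP; split; lra.
pose F x : 'rV[R]_n.+1 := val (f (radial x) : sphere R n).
pose G x : 'rV[R]_n.+1 := - F (- x).
have Funit x : dotv (F x) (F x) = 1 by exact: (eqP (valP (f (radial x) : sphere R n))).
(* Since [0 < 1 + kappa <= 1], this choice gives [1 - (k.+1 * d)^2 / 2 >= - kappa]. *)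
pose d : R := (1 + kappa) / k.+1%:R.
have d0 : 0 < d by rewrite divr_gt0 ?ltr0n //; lra.
have FG x y : 1 <= k.+1%:R * dotv x x -> 1 <= k.+1%:R * dotv y y ->
    (forall i, `|x 0 i - y 0 i| <= d) -> c <= dotv (F x) (G y).
  move=> hx hy hd; rewrite dotvNr lerN2 -geodist_ge_cos; last by apply/andP; split; lra.
  apply: (le_trans (ltW alpha_gt)).
  have y0 : 0 < dotv y y by rewrite -(pmulr_rgt0 _ (ltr0Sn _ k)); lra.
  have dN : dotv (- y) (- y) = dotv y y by rewrite dotvNr dotvC dotvNr opprK.
  have := dotv_radial_ge hx hy hd.
  rewrite /d mulrCA mulfV ?pnatr_eq0 // mulr1.
  have -> : dotv (val (radial x)) (val (radial y)) =
     - dotv (val (radial x)) (val (radial (- y))).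
    by rewrite !(val_radial (x := y), val_radial (x := - y)) ?dN // scalerN dotvNr opprK.
  move=> dxy.
  have le_kappa : dotv (val (radial x)) (val (radial (- y))) <= kappa by nra.
  have /fhom[] // : @adj (Bor k r) (radial x) (radial (- y)).
  split; last first.
    by apply: (le_trans rr'); rewrite geodist_ge_cos //; apply/andP; split; lra.
  (* Equal points would have inner product 1, which exceeds [kappa]. *)
  move=> exy; move: le_kappa; rewrite exy (eqP (valP (radial (- y)))); lra.
pose h x := F x + G x.
apply: (@discrete_borsuk_ulam R k.+1 n.+1 h 2 d (c / n.+1%:R)) => //.
- by rewrite divr_gt0 ?ltr0n.
- by move=> x; rewrite /h /G opprK opprD opprK addrC.
- move=> x i; rewrite !mxE; apply: le_trans (ler_normD _ _) _; rewrite normrN.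
  by have := coord_unit_le1 i (Funit x); have := coord_unit_le1 i (Funit (- x)); lra.
move=> t t1 mt.
exists (fun v => exists2 u, hull (map F t) u &
   exists2 w, hull (map G t) w & v = u + w); split; last first.
- move=> x xt; exists (F x); first exact: hull_sub (map_f F xt).
  by exists (G x); [exact: hull_sub (map_f G xt)|].
- move=> _ [u hu [w hw ->]].
  have cuw : c <= dotv u w.
    apply: hull_dotv_ge hu hw => _ _ /mapP[x xt ->] /mapP[y yt ->].
    apply: FG; [exact: t1|exact: t1|move=> i].
    by rewrite ler_norml; have := mt x y i xt yt; have := mt y x i yt xt; lra.
  case: (pickP (fun i => c / n.+1%:R <= (u + w) 0 i ^+ 2)) => [i ?|none].
    by exists i.
  (* With all squared coordinates small, [|u + w|^2 <= c], against [|u + w|^2 >= 2<u,w> >= 2c]. *)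
  have : dotv (u + w) (u + w) <= c.
    have -> : c = \sum_(i < n.+1) c / n.+1%:R.
      by rewrite sumr_const card_ord -[RHS]mulr_natr divfK ?pnatr_eq0.
    by apply: ler_sum => i _; rewrite -expr2 ltW // ltNge none.
  rewrite dotvDl !dotvDr (dotvC w u).
  by have := dotv_ge0 u; have := dotv_ge0 w; lra.
move=> _ _ a a01 [u hu [w hw ->]] [u' hu' [w' hw' ->]].
exists (a *: u + (1 - a) *: u'); first exact: hull_convex.
exists (a *: w + (1 - a) *: w'); first exact: hull_convex.
by rewrite !scalerDr addrACA.
Qed.
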